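(* Consider the two-dimensional hierarchical heavy hitter algorithm described in the context, over trees of depths $h_1,h_2$, with threshold $\phi\in(0,1]$, and let $A=1+\min(h_1,h_2)$. There exists $\epsilon_0>0$ (depending only on $\phi,h_1,h_2$) such that for every $\epsilon\in(0,\epsilon_0)$ with $1/\epsilon$ a positive integer and every nonempty stream, the set $P$ of prefixes output by the algorithm satisfies $$|P|\le\frac{2}{A\epsilon}\left(\phi-(1+A)\epsilon-\sqrt{(\phi-(1+A)\epsilon)^2-A^2\epsilon}\right).$$
   Context: Hierarchy: rooted trees $T_1,T_2$, all leaves of $T_i$ at depth $h_i$. A prefix is a pair $p=(p_1,p_2)$ of nodes $p_i\in T_i$; fully specified if both are leaves. $e\preceq p$ means $p_i$ is an ancestor of or equal to $e_i$ for $i=1,2$; $e\prec p$ means $e\preceq p$, $e\ne p$. The label of $p$ is $(\mathrm{depth}(p_1),\mathrm{depth}(p_2))$; there are $H=(h_1+1)(h_2+1)$ labels (lattice nodes); $p$ is at level $\mathrm{depth}(p_1)+\mathrm{depth}(p_2)$, and $L=h_1+h_2$. For prefixes $h,h'$: if $h_i,h'_i$ are comparable in $T_i$ for both $i$, $\mathrm{glb}(h,h')$ is the prefix whose $i$-th coordinate is the deeper of $h_i,h'_i$; otherwise $\mathrm{glb}(h,h')$ is a trivial item with count $0$ (and estimate $0$). Stream: updates $(e,c)$, $e$ fully specified, $c$ a positive integer; $N$ is the sum of all $c$ ($N>0$). Space Saving with $m$ counters: maintains at most $m$ items with counters and error values; on $(i,c)$, a tracked $i$ has its counter increased by $c$;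 otherwise if fewer than $m$ items are tracked $i$ is added with counter $c$, error $0$; otherwise an item $j$ with the smallest counter is replaced by $i$ with counter $c(j)+c$ and error $c(j)$. Estimates: tracked $i$: $f_{\max}(i)=c(i)$, $f_{\min}(i)=c(i)-\mathrm{err}(i)$; untracked: $f_{\min}(i)=0$, $f_{\max}(i)=$ smallest counter (or $0$ if fewer than $m$ items are tracked). Algorithm: one Space Saving instance with $1/\epsilon$ counters per label; on update $(e,c)$, for every prefix $p$ with $e\preceq p$ feed $(p,c)$ to the instance of $p$'s label; $f_{\min}(p),f_{\max}(p)$ are that instance's estimates. Output procedure with threshold $\phi$: $P=\emptyset$; for levels $l=L,L-1,\dots,0$, for each prefix $p$ at level $l$: let $H_p=\{h\in P: h\prec p,\ \nexists h'\in P \text{ with } h\prec h'\prec p\}$; set $F'_p=f_{\max}(p)-\sum_{h\in H_p}f_{\min}(h)+\sum f_{\max}(q)$, where the last sum is over unordered pairs $\{h,h'\}$ of distinct elements of $H_p$ with $q=\mathrm{glb}(h,h')$ such that there is no $h_3\in H_p\setminus\{h,h'\}$ with $q\preceq h_3$; if $F'_p\ge\phi N$, add $p$ to $P$ and output $p$ with $f_{\min}(p),f_{\max}(p)$. *)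

(* Defs.v *)
From HB Require Import structures.
From mathcomp Require Import all_boot all_order all_algebra.
From mathcomp Require Import reals.
Set Implicit Arguments. Unset Strict Implicit. Unset Printing Implicit Defensive.
Import Order.TTheory GRing.Theory Num.Theory.

Section Tree.
Variables (T : finType) (r : T) (par : T -> T).

Definition is_rtree : Prop := par r = r /\ forall x, iter #|T| par x = r.

Definition anc (y x : T) : bool := [exists k : 'I_#|T|.+1, iter k par x == y].

Definition depth (x : T) : nat := find (fun k => iter k par x == r) (iota 0 #|T|.+1).

(* a leaf has no child other than (possibly) itself (par r = r) *)
Definition leaf (x : T) : bool := [forall y, (par y == x) ==> (y == x)].

Definition leaves_at (h : nat) : Prop := forall x, leaf x -> depth x = h.

Definition comparable (x y : T) : bool := anc x y || anc y x.
Definition deeper (x y : T) : T := if anc x y then y else x.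
End Tree.

(* ---------- Space Saving (relational: any tie-breaking allowed) ---------- *)
Section SpaceSaving.
Variable K : finType.
Definition ss_state := {ffun K -> option (nat * nat)}. (* Some (counter, error) *)
Definition ss_empty : ss_state := [ffun _ => None].
Definition tracked (S : ss_state) : {set K} := [set x | S x != None].
Definition cnt (S : ss_state) x : nat := if S x is Some (a, _) then a else 0.

Definition ss_step (m : nat) (S : ss_state) (i : K) (c : nat) (S' : ss_state) : Prop :=
  if S i is Some (a, e) then S' = [ffun x => if x == i then Some (a + c, e) else S x]
  else if #|tracked S| < m then S' = [ffun x => if x == i then Some (c, 0) else S x]
  else exists j, j \in tracked S /\ (forall x, x \in tracked S -> cnt S j <= cnt S x) /\
       S' = [ffun x => if x == i then Some (cnt S j + c, cnt S j)
                       else if x == j then None else S x].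

Definition ss_min (S : ss_state) : nat :=
  \big[minn/(\max_x cnt S x)]_(x in tracked S) cnt S x.

Definition ss_fmax (m : nat) (S : ss_state) (i : K) : nat :=
  if S i is Some (a, _) then a else if #|tracked S| < m then 0 else ss_min S.
Definition ss_fmin (S : ss_state) (i : K) : nat :=
  if S i is Some (a, e) then a - e else 0.
End SpaceSaving.

Section HHH.
Variables (T1 : finType) (r1 : T1) (par1 : T1 -> T1).
Variables (T2 : finType) (r2 : T2) (par2 : T2 -> T2).
Notation prefix := (T1 * T2)%type.

Definition pre_le (e p : prefix) : bool := anc par1 p.1 e.1 && anc par2 p.2 e.2.
Definition pre_lt (e p : prefix) : bool := pre_le e p && (e != p).
Definition label (p : prefix) : nat * nat := (depth r1 par1 p.1, depth r2 par2 p.2).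
Definition level (p : prefix) : nat := depth r1 par1 p.1 + depth r2 par2 p.2.

(* None encodes the trivial item (count 0, estimate 0) *)
Definition glb (h h' : prefix) : option prefix :=
  if comparable par1 h.1 h'.1 && comparable par2 h.2 h'.2
  then Some (deeper par1 h.1 h'.1, deeper par2 h.2 h'.2) else None.

Definition full_spec (p : prefix) : bool := leaf par1 p.1 && leaf par2 p.2.

(* one Space Saving instance per label *)
Definition alg_state := nat * nat -> ss_state prefix.
Definition alg_init : alg_state := fun _ => ss_empty prefix.

Definition alg_step (m : nat) (St : alg_state) (e : prefix) (c : nat) (St' : alg_state) : Prop :=
  forall l, (exists p, pre_le e p /\ label p = l /\ ss_step m (St l) p c (St' l))
            \/ ((forall p, pre_le e p -> label p <> l) /\ St' l = St l).

Fixpoint alg_run (m : nat) (St : alg_state) (s : seq (prefix * nat)) (St' : alg_state) : Prop :=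
  match s with
  | [::] => St' = St
  | u :: s' => exists St1, alg_step m St u.1 u.2 St1 /\ alg_run m St1 s' St'
  end.

Definition valid_stream (s : seq (prefix * nat)) : bool :=
  all (fun u => full_spec u.1 && (0 < u.2)%N) s.
Definition stream_N (s : seq (prefix * nat)) : nat := \sum_(u <- s) u.2.

Definition fmax (m : nat) (St : alg_state) (p : prefix) : nat := ss_fmax m (St (label p)) p.
Definition fmin (St : alg_state) (p : prefix) : nat := ss_fmin (St (label p)) p.

Variable R : realType.
Local Open Scope ring_scope.

Definition Hset (P : {set prefix}) (p : prefix) : {set prefix} :=
  [set h in P | pre_lt h p &&
     [forall h', ~~ [&& h' \in P, pre_lt h h' & pre_lt h' p]]].

Definition pair_term (m : nat) (St : alg_state) (H : {set prefix}) (h h' : prefix) : R :=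
  match glb h h' with
  | Some q => if [forall h3, [&& h3 \in H, h3 != h & h3 != h'] ==> ~~ pre_le q h3]
              then (fmax m St q)%:R else 0
  | None => 0
  end.

(* F'_p ; the sum over unordered pairs is half the sum over ordered pairs of distinct elements *)
Definition Fp (m : nat) (St : alg_state) (P : {set prefix}) (p : prefix) : R :=
  let H := Hset P p in
  (fmax m St p)%:R - \sum_(h in H) (fmin St h)%:R
  + 2^-1 * \sum_(h in H) \sum_(h' in H | h' != h) pair_term m St H h h'.

Fixpoint outQ (m : nat) (St : alg_state) (phi : R) (N L n : nat) : {set prefix} :=
  match n with
  | 0 => set0
  | n'.+1 => let Q := outQ m St phi N L n' in
             Q :|: [set p | (level p == (L - n')%N) && (phi * N%:R <= Fp m St Q p)]
  end.

Definition output (m : nat) (St : alg_state) (phi : R) (N L : nat) : {set prefix} :=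
  outQ m St phi N L L.+1.
End HHH.

(* Main.v *)
(** For a subset [S] of the output [P] that contains every element of [P] below one of its own,
    sum [phi N <= F'_p] over [p] in [S].  The Space Saving estimates are off by at most [N / k], where
    [k] is the number of counters, and on exact counts [F'_p] is at most the number of stream items below
    [p] that no element of [H_p] covers.  The prefixes that leave a given item uncovered, and those whose
    [H_p] contains a given [h], form antichains of ancestors of one prefix, hence there are at most
    [A = 1 + min(h1, h2)] of them.  Joining [h] and [h'] when their glb counts in some [F'_p] gives a
    triangle-free graph on [S]: among three pairwise comparable and incomparable prefixes the middle one
    lies above the glb of the other two.  By Mantel's theorem the glb terms contribute an error of at most
    [A |S|^2 / 4], so every [j <= |P|] satisfies
    [phi j <= A + (j + A j + A j^2 / 4) / k], and the bound is the smaller root of this quadratic. *)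
Require Import Defs.
From HB Require Import structures.
From mathcomp Require Import all_boot all_order all_algebra.
From mathcomp Require Import reals.
From mathcomp Require Import zify ring lra.
Set Implicit Arguments. Unset Strict Implicit. Unset Printing Implicit Defensive.
Import Order.TTheory GRing.Theory Num.Theory.

(** * Ancestors in a rooted tree *)

Section RootedTree.
Variables (T : finType) (r : T) (par : T -> T).
Hypothesis treeT : is_rtree r par.
Local Notation anc := (anc par).
Local Notation depth := (depth r par).
Local Notation comparable := (Defs.comparable par).
Local Notation deeper := (deeper par).

Lemma iter_par_root k : iter k par r = r.
Proof. by case: treeT => rr _; elim: k => //= k ->. Qed.

Lemma iter_par_leq j k x : iter j par x = r -> j <= k -> iter k par x = r.
Proof. by move=> jx le_jk; rewrite -(subnK le_jk) iterD jx iter_par_root. Qed.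

Lemma depth_leq x k : (depth x <= k) = (iter k par x == r).
Proof.
have hx : has (fun k => iter k par x == r) (iota 0 #|T|.+1).
  apply/hasP; exists #|T|; first by rewrite mem_iota ltnS leqnn.
  by case: treeT => _ ->.
apply/idP/eqP => [le_k|kx].
  apply: iter_par_leq le_k; apply/eqP; have := nth_find 0 hx.
  by rewrite nth_iota // -[X in _ < X](size_iota 0) -has_find.
rewrite leqNgt; apply/negP => lt_k; have := before_find 0 lt_k.
rewrite nth_iota ?add0n ?kx ?eqxx //.
by rewrite (leq_trans lt_k) // -[X in _ <= X](size_iota 0) find_size.
Qed.

Lemma depth_iter x k : depth (iter k par x) = depth x - k.
Proof.
have le_iff j : (depth (iter k par x) <= j) = (depth x - k <= j).
  by rewrite depth_leq -iterD -depth_leq leq_subLR addnC.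
by apply/eqP; rewrite eqn_leq le_iff leqnn -le_iff leqnn.
Qed.

Lemma ancP y x : reflect (exists k, iter k par x = y) (anc y x).
Proof.
apply: (iffP existsP) => [[k /eqP ky]|[k ky]]; first by exists k.
have [le_kT|lt_Tk] := leqP k #|T|.
  by exists (Ordinal (le_kT : k < #|T|.+1)); apply/eqP.
exists ord_max; rewrite /= -ky (iter_par_leq _ (ltnW lt_Tk)); case: treeT => _ -> //.
Qed.

(** Each step up lowers the depth by one until the root, so depths tell how far to climb; a climb
    past the root ends at the root anyway. *)
Lemma anc_iter y x : anc y x -> iter (depth x - depth y) par x = y.
Proof.
case/ancP => k <-; rewrite depth_iter.
have [le_kx|/ltnW le_xk] := leqP k (depth x); first by rewrite subKn.
rewrite (eqP le_xk) subn0 (iter_par_leq _ le_xk); apply/eqP;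
  by rewrite -depth_leq.
Qed.

Lemma anc_refl x : anc x x.
Proof. by apply/ancP; exists 0. Qed.

Lemma anc_trans y x z : anc x y -> anc y z -> anc x z.
Proof.
by move=> /ancP[k <-] /ancP[j <-]; apply/ancP; exists (k + j); rewrite iterD.
Qed.

Lemma anc_depth y x : anc y x -> depth y <= depth x.
Proof. by case/ancP => k <-; rewrite depth_iter leq_subr. Qed.

Lemma anc_eq y x : anc y x -> depth x <= depth y -> y = x.
Proof. by move=> /anc_iter yx /eqP d0; rewrite -yx d0. Qed.

Lemma anc_depth_inj x y z : anc y x -> anc z x -> depth y = depth z -> y = z.
Proof. by move=> /anc_iter yx /anc_iter zx d_yz; rewrite -yx -zx d_yz. Qed.

Lemma anc_chain x y z : anc y x -> anc z x -> depth y <= depth z -> anc y z.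
Proof.
move=> /[dup] /anc_depth d1 /anc_iter yx /[dup] /anc_depth d2 /anc_iter zx le_yz.
apply/ancP; exists (depth z - depth y).
transitivity (iter (depth z - depth y) par (iter (depth x - depth z) par x)).
  by rewrite zx.
by rewrite -iterD (_ : _ + _ = depth x - depth y) //; lia.
Qed.

Lemma comparable_anc x y : comparable x y -> depth x <= depth y -> anc x y.
Proof.
by case/orP => // yx /(anc_eq yx) ->; apply: anc_refl.
Qed.

Lemma comparable_ancs x y z : anc x z -> anc y z -> comparable x y.
Proof.
move=> xz yz; rewrite /Defs.comparable.
have [le_xy|/ltnW le_yx] := leqP (depth x) (depth y).
  by rewrite (anc_chain xz yz).
by rewrite (anc_chain yz xz) ?orbT.
Qed.

Lemma comparableC x y : comparable x y = comparable y x.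
Proof. exact: orbC. Qed.

Lemma anc_deeper x y z :
  comparable x y -> anc (deeper x y) z = anc x z && anc y z.
Proof.
rewrite /Defs.deeper /Defs.comparable; case: ifP => /= [xy _ | _ yx].
  by apply/idP/andP => [yz|[]//]; split=> //; apply: anc_trans yz.
by apply/idP/andP => [xz|[]//]; split=> //; apply: anc_trans xz.
Qed.

Lemma deeperC x y : comparable x y -> deeper x y = deeper y x.
Proof.
rewrite /Defs.deeper /Defs.comparable; case: ifP => /= [xy _ | _ ->] //.
by case: ifP => // yx; rewrite (anc_eq yx (anc_depth xy)).
Qed.

(** A deepest node is a leaf: a child no deeper than its parent has depth 0, hence is the root, its
    own parent. *)
Lemma leaves_at_depth h x : leaves_at r par h -> depth x <= h.
Proof.
move=> leafh; have [y _ max_y] := @arg_maxnP _ x xpredT depth isT.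
suff /leafh <- : leaf par y by apply: max_y.
apply/forallP => z; apply/implyP => /eqP zy.
have := max_y z isT; rewrite -zy (depth_iter z 1) => le_z.
have : depth z <= 0 by lia.
by rewrite depth_leq /= => /eqP ->; case: treeT => ->.
Qed.
End RootedTree.

(** * Space Saving *)

Lemma bigminn_le_cond (I : eqType) (s : seq I) (P : pred I) (F : I -> nat) d j :
  j \in s -> P j -> \big[minn/d]_(i <- s | P i) F i <= F j.
Proof.
elim: s => // x s IHs; rewrite inE big_cons => /orP[/eqP <- -> | js Pj].
  exact: geq_minl.
by case: ifP => _; rewrite ?geq_min IHs ?orbT.
Qed.

Section SpaceSavingBounds.
Variables (K : finType) (m : nat).
Implicit Types (S : ss_state K) (g : K -> nat) (N : nat).

(** [g] is the true count and [N] bounds the weight received. The form [a <= g x + e] avoids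
    truncated subtraction, and [e * m <= N] encodes an error of at most [N / m]. *)
Definition ss_inv S g N : Prop :=
  [/\ #|tracked S| <= m, \sum_x cnt S x <= N,
      forall x a e, S x = Some (a, e) ->
        [/\ e <= a, a <= g x + e, g x <= a & e * m <= N] &
      forall x, S x = None ->
        if #|tracked S| < m then g x = 0
        else forall y, y \in tracked S -> g x <= cnt S y].

Lemma ss_inv_empty : ss_inv (ss_empty K) (fun=> 0) 0.
Proof.
split=> [|| x a e | x _].
- by rewrite [tracked _](_ : _ = set0) ?cards0 //; apply/setP => x; rewrite !inE ffunE.
- by rewrite big1 // => x _; rewrite /cnt ffunE.
- by rewrite ffunE.
- by case: ifP.
Qed.

Lemma eq_ss_inv S g g' N : g =1 g' -> ss_inv S g N -> ss_inv S g' N.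
Proof.
move=> eq_g [cS sS tS uS]; split=> // [x a e|x].
  by rewrite -eq_g; apply: tS.
by rewrite -eq_g; apply: uS.
Qed.

Lemma ss_inv_weaken S g N N' : N <= N' -> ss_inv S g N -> ss_inv S g N'.
Proof.
move=> leN [cS sS tS uS]; split=> // [|x a e /tS[? ? ? eN]].
  exact: leq_trans leN.
by split=> //; apply: leq_trans leN.
Qed.

(** In a full table this puts the smallest counter at or below [N / m], the source of the error
    bounds. *)
Lemma ss_sum_ge S v : (forall x, x \in tracked S -> v <= cnt S x) ->
  v * #|tracked S| <= \sum_x cnt S x.
Proof.
move=> lev; rewrite mulnC -sum_nat_const [leqRHS](bigID (mem (tracked S))) /=.
by apply: leq_trans (leq_addr _ _); apply: leq_sum.
Qed.

Lemma cnt_untracked S x : S x = None -> cnt S x = 0.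
Proof. by rewrite /cnt => ->. Qed.

Lemma sum_update (F F' : K -> nat) i : (forall x, x != i -> F' x = F x) ->
  \sum_x F' x + F i = \sum_x F x + F' i.
Proof.
move=> eqF; rewrite (bigD1 i) //= [in RHS](bigD1 i) //=.
by rewrite (eq_bigr F) => [|x /eqF //]; lia.
Qed.

Lemma ss_inv_step S g N i c S' : ss_inv S g N -> ss_step m S i c S' ->
  ss_inv S' (fun x => g x + (x == i) * c) (N + c).
Proof.
move=> [cS sS tS uS]; rewrite /ss_step; case Si: (S i) => [[a e]|].
  move=> ->; set S1 := finfun _.
  have trS : tracked S1 = tracked S.
    by apply/setP => x; rewrite !inE ffunE; case: (x =P i) => // ->; rewrite Si.
  have cnt_ge y : cnt S y <= cnt S1 y.
    by rewrite /cnt ffunE; case: eqP => // ->; rewrite Si leq_addr.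
  split; rewrite ?trS //.
  - have /sum_update : forall x, x != i -> cnt S1 x = cnt S x.
      by move=> x /negPf ne; rewrite /cnt ffunE ne.
    have -> : cnt S1 i = a + c by rewrite /cnt ffunE eqxx.
    have -> : cnt S i = a by rewrite /cnt Si.
    lia.
  - move=> x b f; rewrite ffunE; case: eqP => [->|_].
      by case=> <- <-; case: (tS _ _ _ Si) => *; split; lia.
    by case/tS => *; split; lia.
  - move=> x; rewrite ffunE; case: eqP => // _ /uS; case: ifP => _; first by rewrite addn0.
    by move=> le_g y /le_g; rewrite addn0 => /leq_trans; apply.
case: ltnP => [lt_m ->|le_m [j [jS [minj ->]]]]; set S1 := finfun _.
  have trS : tracked S1 = i |: tracked S.
    by apply/setP => x; rewrite !inE ffunE; case: (x =P i).
  have gi : g i = 0 by have := uS _ Si; rewrite lt_m.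
  split; rewrite ?trS ?cardsU1 ?inE ?Si /=.
  - lia.
  - have /sum_update : forall x, x != i -> cnt S1 x = cnt S x.
      by move=> x /negPf ne; rewrite /cnt ffunE ne.
    have -> : cnt S1 i = c by rewrite /cnt ffunE eqxx.
    have -> : cnt S i = 0 by rewrite /cnt Si.
    lia.
  - move=> x b f; rewrite ffunE; case: eqP => [->|_].
      by case=> <- <-; split; lia.
    by case/tS => *; split; lia.
  - move=> x; rewrite ffunE; case: eqP => // _ /uS; rewrite lt_m => ->.
    by case: ifP.
have cSm : #|tracked S| = m by apply/eqP; rewrite eqn_leq cS.
have ne_ij : (j == i) = false.
  by apply/eqP => ji; move: jS; rewrite ji inE Si.
(* [cnt S j] becomes the error of the newcomer [i]. *)
have sumj : cnt S j * m <= N by rewrite -cSm; apply: leq_trans sS; apply: ss_sum_ge.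
have trS : tracked S1 = i |: (tracked S :\ j).
  by apply/setP => x; rewrite !inE ffunE; case: (x =P i) => //= _; case: (x =P j).
have cardS1 : #|tracked S1| = m.
  by rewrite trS cardsU1 !inE Si andbF /= -cSm (cardsD1 j (tracked S)) jS.
have uS1 x : S x = None -> forall y, y \in tracked S -> g x <= cnt S y.
  by move=> /uS; rewrite cSm ltnn.
have cnt_ge y : y \in tracked S1 -> cnt S j <= cnt S1 y.
  rewrite trS !inE /cnt ffunE; case: eqP => [_ _|_ /=]; first exact: leq_addr.
  by case: eqP => //= _ yS; apply: minj; rewrite inE.
split; rewrite ?cardS1 //.
(* The eviction is split into two one-point updates, zeroing [j] and then writing [i]; the total
   grows by [c]. *)
- have := @sum_update (cnt S) (fun x => if x == j then 0 else cnt S x) j.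
  have := @sum_update (fun x => if x == j then 0 else cnt S x) (cnt S1) i.
  rewrite eqxx [i == j]eq_sym ne_ij (cnt_untracked Si) /= => s1 s2.
  have c1 : cnt S1 i = cnt S j + c by rewrite /cnt ffunE eqxx.
  suff : forall x, x != i -> cnt S1 x = if x == j then 0 else cnt S x.
    move=> /s1; have /s2 : forall x, x != j -> (if x == j then 0 else cnt S x) = cnt S x.
      by move=> x /negPf ->.
    lia.
  by move=> x /negPf ne; rewrite /cnt ffunE ne; case: eqP.
- move=> x b f; rewrite ffunE; case: eqP => [->|_].
    by case=> <- <-; have := uS1 _ Si _ jS; split; lia.
  by case: eqP => // _ /tS[] *; split; lia.
(* The evicted [j] joins the untracked keys: its true count is at most its old counter, which was
   the smallest. *)
- move=> x; rewrite ltnn ffunE; case: eqP => // _; rewrite addn0; case: eqP => [-> _|_ Sx] y yT.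
    apply: leq_trans (cnt_ge y yT); move: jS; rewrite inE /cnt.
    by case Sj: (S j) => [[b f]|//] _; case: (tS _ _ _ Sj).
  by apply: leq_trans (cnt_ge y yT); apply: uS1.
Qed.

Lemma ss_fmax_le S g N x : ss_inv S g N -> ss_fmax m S x * m <= g x * m + N.
Proof.
move=> [cS sS tS uS]; rewrite /ss_fmax; case Sx: (S x) => [[a e]|].
  by case: (tS _ _ _ Sx) => *; nia.
case: ltnP => // le_m; apply: leq_trans (leq_addl _ _).
have cSm : #|tracked S| = m by apply/eqP; rewrite eqn_leq cS.
rewrite -cSm; apply: leq_trans sS; apply: ss_sum_ge => y yS.
by apply: bigminn_le_cond; rewrite ?mem_index_enum.
Qed.

Lemma ss_fmin_ge S g N x : ss_inv S g N -> g x * m <= ss_fmin S x * m + N.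
Proof.
move=> [cS sS tS uS]; rewrite /ss_fmin; case Sx: (S x) => [[a e]|].
  by case: (tS _ _ _ Sx) => *; nia.
have := uS _ Sx; case: ltnP => [_ -> // | le_m le_g].
have cSm : #|tracked S| = m by apply/eqP; rewrite eqn_leq cS.
by rewrite -[in g x * m]cSm (leq_trans _ sS) // ss_sum_ge.
Qed.
End SpaceSavingBounds.

(** * Prefixes and their estimates *)

Section PrefixOrder.
Variables (T1 : finType) (r1 : T1) (par1 : T1 -> T1).
Variables (T2 : finType) (r2 : T2) (par2 : T2 -> T2).
Hypotheses (tree1 : is_rtree r1 par1) (tree2 : is_rtree r2 par2).
Notation prefix := (T1 * T2)%type.
Local Notation label := (label r1 par1 r2 par2).
Local Notation level := (level r1 par1 r2 par2).
Local Notation pre_le := (pre_le par1 par2).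
Local Notation pre_lt := (pre_lt par1 par2).
Local Notation depth1 := (Defs.depth r1 par1).
Local Notation depth2 := (Defs.depth r2 par2).
Implicit Types (e p q h x y z : prefix).

Lemma pre_le_refl p : pre_le p p.
Proof. by rewrite /Defs.pre_le (anc_refl tree1) (anc_refl tree2). Qed.

Lemma pre_le_trans p e q : pre_le e p -> pre_le p q -> pre_le e q.
Proof.
move=> /andP[a1 a2] /andP[b1 b2].
by rewrite /Defs.pre_le (anc_trans tree1 b1 a1) (anc_trans tree2 b2 a2).
Qed.

Lemma pre_ltW e p : pre_lt e p -> pre_le e p.
Proof. by case/andP. Qed.

Lemma pre_lt_level e p : pre_lt e p -> level p < level e.
Proof.
case/andP=> /andP[a1 a2]; rewrite ltnNge; apply: contra => le_l; apply/eqP.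
have d1 := anc_depth tree1 a1; have d2 := anc_depth tree2 a2.
have l1 : depth1 e.1 <= depth1 p.1.
  by rewrite -(leq_add2r (depth2 e.2)) (leq_trans le_l) // leq_add2l.
have l2 : depth2 e.2 <= depth2 p.2.
  by rewrite -(leq_add2l (depth1 e.1)) (leq_trans le_l) // leq_add2r.
by rewrite [e]surjective_pairing [p]surjective_pairing (anc_eq tree1 a1 l1) (anc_eq tree2 a2 l2).
Qed.

(** In each tree an ancestor of [e] is fixed by its depth. Hence an update reaches at most one
    prefix of each label, and one Space Saving step per instance accounts for it. *)
Lemma label_inj e p q : pre_le e p -> pre_le e q -> label p = label q -> p = q.
Proof.
case: p q => [p1 p2] [q1 q2] /andP[/= a1 a2] /andP[/= b1 b2] [l1 l2].
rewrite -(anc_iter tree1 a1) -(anc_iter tree1 b1) -(anc_iter tree2 a2) -(anc_iter tree2 b2).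
by rewrite l1 l2.
Qed.

Section Counts.
Variable m : nat.
Implicit Types (St : alg_state T1 T2) (s : seq (prefix * nat)) (g : prefix -> nat).

Definition fcount s p := \sum_(u <- s | pre_le u.1 p) u.2.

(** The factor [label x == l] sets to 0 the count of prefixes that belong to other instances. *)
Definition alg_inv St g N := forall l,
  ss_inv m (St l) (fun x => (label x == l) * g x) N.

Lemma alg_inv_step St g N e c St' :
  alg_inv St g N -> alg_step r1 par1 r2 par2 m St e c St' ->
  alg_inv St' (fun x => g x + pre_le e x * c) (N + c).
Proof.
move=> inv step l; case: (step l) => [[p [ep [lp]]] | [no_p ->]].
  move/(ss_inv_step (inv l)); apply: eq_ss_inv => x.
  case: (label x =P l) => [lx|nlx]; last by case: eqP => // xp; case: nlx; rewrite xp.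
  case: eqP => [-> | nxp]; first by rewrite ep !mul1n.
  case ex: (pre_le e x); rewrite ?mul0n ?mul1n //.
  by case: nxp; apply: (label_inj ex ep); rewrite lp.
apply: ss_inv_weaken (leq_addr c N) _; apply: eq_ss_inv (inv l) => x.
case: (label x =P l) => //= lx; case ex: (pre_le e x); last by rewrite addn0.
by case: (no_p _ ex).
Qed.

Lemma alg_inv_run St s St' g N : alg_inv St g N ->
  alg_run r1 par1 r2 par2 m St s St' ->
  alg_inv St' (fun x => g x + fcount s x) (N + stream_N s).
Proof.
elim: s St g N => [|u s IHs] St g N /= inv.
  move=> -> l; rewrite /stream_N big_nil addn0; apply: eq_ss_inv (inv l) => x.
  by rewrite /fcount big_nil addn0.
case=> St1 [/(alg_inv_step inv) /IHs{}IHs /IHs {}IHs] l.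
rewrite /stream_N big_cons addnA; apply: eq_ss_inv (IHs l) => x.
by rewrite /fcount big_cons -addnA; case: pre_le; rewrite ?mul1n.
Qed.

Variables (s : seq (prefix * nat)) (St : alg_state T1 T2).
Hypothesis run : alg_run r1 par1 r2 par2 m (alg_init T1 T2) s St.

Lemma alg_run_inv : alg_inv St (fcount s) (stream_N s).
Proof.
suff inv0 : alg_inv (alg_init T1 T2) (fun=> 0) 0 by apply: (alg_inv_run inv0 run).
by move=> l; apply: eq_ss_inv (ss_inv_empty _ m) => x; rewrite muln0.
Qed.

Lemma fmax_le p : fmax r1 par1 r2 par2 m St p * m <= fcount s p * m + stream_N s.
Proof. by have := ss_fmax_le p (alg_run_inv (label p)); rewrite eqxx mul1n. Qed.

Lemma fmin_ge p : fcount s p * m <= fmin r1 par1 r2 par2 St p * m + stream_N s.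
Proof. by have := ss_fmin_ge p (alg_run_inv (label p)); rewrite eqxx mul1n. Qed.
End Counts.
End PrefixOrder.

(** * Counting edges *)

(** The neighbourhood [I] of a vertex of maximal degree is independent, so edges at [I] lead to
    [S :\: I]. The degree sum is thus at most twice the one over [S :\: I], hence at most
    [2 * #|S :\: I| * #|I|], and AM-GM concludes. *)
Lemma mantel (T : finType) (S : {set T}) (E : rel T) :
    symmetric E -> (forall x y, E x y -> x \in S) ->
    (forall x y z, E x y -> E y z -> E x z -> False) ->
  2 * \sum_(x in S) #|[set y | E x y]| <= #|S| ^ 2.
Proof.
move=> symE ES triE.
have [->|[v0 v0S]] := set_0Vmem S; first by rewrite big_set0.
have [v vS max_v] := @arg_maxnP _ v0 (mem S) (fun x => #|[set y | E x y]|) v0S.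
pose I := [set y | E v y].
have sIS : I \subset S by apply/subsetP => y; rewrite inE symE; apply: ES.
rewrite (big_setID I) /= (setIidPr sIS).
have leI : \sum_(x in I) #|[set y | E x y]| <= \sum_(x in S :\: I) #|[set y | E x y]|.
  pose e x y : nat := E x y.
  have -> : \sum_(x in I) #|[set y | E x y]| = \sum_(x in I) \sum_(y in S :\: I) e x y.
    apply: eq_bigr => x xI; rewrite -sum1dep_card big_mkcond [RHS]big_mkcond /=.
    apply: eq_bigr => y _; rewrite /e !inE; case xy: (E x y); last by rewrite if_same.
    have -> : y \in S by apply: (ES _ x); rewrite symE.
    case vy: (E v y) => //=.
    by case: (triE v x y) => //; move: xI; rewrite inE.
  rewrite exchange_big /=; apply: leq_sum => y _.
  rewrite -sum1dep_card [leqLHS]big_mkcond [leqRHS]big_mkcond /=; apply: leq_sum => x _.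
  by rewrite /e symE; case: (E y x); case: (x \in I).
have leD : \sum_(x in S :\: I) #|[set y | E x y]| <= #|S :\: I| * #|I|.
  by rewrite -sum_nat_const; apply: leq_sum => x; rewrite inE => /andP[_ /max_v].
have := cardsID I S; rewrite (setIidPr sIS) => <-.
have [AGM _] := nat_AGM2 #|S :\: I| #|I|; rewrite [#|I| + _]addnC; apply: leq_trans AGM; lia.
Qed.

(** By the last hypothesis [x] is joined upwards only to the next element of [C], so it has at most
    one upper neighbour; the top element has none, which gives the extra 1. *)
Lemma card_upper_neighbours (T : finType) (C : {set T}) (E : rel T) (d : T -> nat) :
    (forall x y, E x y -> y \in C) ->
    (forall x y, x \in C -> y \in C -> d x = d y -> x = y) ->
    (forall x y z, x \in C -> y \in C -> d x < d y -> d y < d z -> ~~ E x z) ->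
  \sum_(x in C) #|[set y | E x y & d x < d y]| + (C != set0) <= #|C|.
Proof.
move=> EC injd conv.
have [->|[M0 M0C]] := set_0Vmem C; first by rewrite big_set0 eqxx.
have [M MC maxM] := @arg_maxnP _ M0 (mem C) d M0C.
have -> : C != set0 by apply/set0Pn; exists M.
rewrite (bigD1 M) //= (_ : [set y | _ & _] = set0) ?cards0; last first.
  apply/setP => y; rewrite !inE; apply/negP => /andP[/EC/maxM]; lia.
rewrite (cardsD1 M C) (MC : M \in C) addn1 ltnS.
have -> : #|C :\ M| = \sum_(x in C | x != M) 1.
  by rewrite sum1dep_card; apply: eq_card => x; rewrite !inE andbC.
apply: leq_sum => x /andP[xC _]; apply/card_le1_eqP => y z; rewrite !inE.
move=> /andP[xy lxy] /andP[xz lxz]; have [yC zC] := (EC _ _ xy, EC _ _ xz).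
case: (ltngtP (d y) (d z)) => [lt|lt|]; last by move=> /injd ->.
- by rewrite (negPf (conv _ _ _ xC yC lxy lt)) in xz.
- by rewrite (negPf (conv _ _ _ xC zC lxz lt)) in xy.
Qed.

(** The graph is a union of paths along the order of [d]. The bound on upper neighbours is used for
    [d] and for the reversed order [D - d x], where [D] is the maximum of [d] on [C], so that
    nothing is truncated. *)
Lemma card_chain_neighbours (T : finType) (C : {set T}) (E : rel T) (d : T -> nat) :
    irreflexive E -> symmetric E -> (forall x y, E x y -> y \in C) ->
    (forall x y, x \in C -> y \in C -> d x = d y -> x = y) ->
    (forall x y z, x \in C -> y \in C -> z \in C -> d x < d y -> d y < d z -> ~~ E x z) ->
  \sum_(x in C) #|[set y | E x y]| + 2 * (C != set0) <= 2 * #|C|.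
Proof.
move=> irE symE EC injd conv.
have Eneq x y : E x y -> d x != d y.
  move=> xy; apply/eqP => /injd eq_xy; move: (xy).
  by rewrite eq_xy ?irE ?(EC _ _ xy) //; apply: (EC y); rewrite symE.
have up := @card_upper_neighbours _ C E d EC injd.
pose D := \max_(x in C) d x.
have dn := @card_upper_neighbours _ C E (fun x => D - d x) EC.
have leD x : x \in C -> d x <= D by move=> xC; apply: (@leq_bigmax_cond _ (mem C) d x).
have {}up : \sum_(x in C) #|[set y | E x y & d x < d y]| + (C != set0) <= #|C|.
  apply: up => x y z xC yC lxy lyz; apply/negP => xz.
  by move: (EC _ _ xz) => zC; move: xz; apply/negP; apply: (conv x y).
have {}dn : \sum_(x in C) #|[set y | E x y & D - d x < D - d y]| + (C != set0) <= #|C|.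
  apply: dn => [x y xC yC|x y z xC yC lxy lyz].
    by have := leD _ xC; have := leD _ yC; move=> ? ? ?; apply: injd => //; lia.
  apply/negP => xz; move: (EC _ _ xz) => zC; move: xz; apply/negP.
  by rewrite symE; apply: (conv z y) => //; lia.
rewrite [X in X + _](_ : _ = \sum_(x in C) #|[set y | E x y & d x < d y]| +
   \sum_(x in C) #|[set y | E x y & D - d x < D - d y]|); first lia.
rewrite -big_split /=; apply: eq_bigr => x xC.
rewrite -(cardsID [set y | d x < d y] [set y | E x y]); congr (_ + _); apply: eq_card => y.
  by rewrite !inE.
rewrite !inE andbC; case xy: (E x y) => //=.
have := leD _ xC; have := leD _ (EC _ _ xy); have := Eneq _ _ xy; lia.
Qed.

(** * Antichains of prefixes *)

Section Antichains.
Variables (T1 : finType) (r1 : T1) (par1 : T1 -> T1).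
Variables (T2 : finType) (r2 : T2) (par2 : T2 -> T2).
Hypotheses (tree1 : is_rtree r1 par1) (tree2 : is_rtree r2 par2).
Notation prefix := (T1 * T2)%type.
Local Notation level := (level r1 par1 r2 par2).
Local Notation pre_le := (pre_le par1 par2).
Local Notation pre_lt := (pre_lt par1 par2).
Local Notation Hset := (Hset par1 par2).
Local Notation depth1 := (Defs.depth r1 par1).
Local Notation depth2 := (Defs.depth r2 par2).
Local Notation comparable1 := (Defs.comparable par1).
Local Notation comparable2 := (Defs.comparable par2).
Implicit Types (e p q h x y z : prefix) (H P S : {set prefix}).

Definition pcomparable x y := comparable1 x.1 y.1 && comparable2 x.2 y.2.
Definition pglb x y : prefix := (deeper par1 x.1 y.1, deeper par2 x.2 y.2).
Definition antichain H := forall x y, x \in H -> y \in H -> pre_le x y -> x = y.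

Lemma pre_le_pglb e x y :
  pcomparable x y -> pre_le e (pglb x y) = pre_le e x && pre_le e y.
Proof.
case/andP=> c1 c2; rewrite /Defs.pre_le /= (anc_deeper tree1) // (anc_deeper tree2) //.
by rewrite andbACA.
Qed.

Lemma pcomparableC x y : pcomparable x y = pcomparable y x.
Proof. by rewrite /pcomparable !(comparableC _ x.1) !(comparableC _ x.2). Qed.

Lemma pglbC x y : pcomparable x y -> pglb x y = pglb y x.
Proof. by case/andP=> *; rewrite /pglb (deeperC tree1) // (deeperC tree2). Qed.

Lemma pre_le_pcomparable e x y : pre_le e x -> pre_le e y -> pcomparable x y.
Proof.
move=> /andP[a1 a2] /andP[b1 b2].
by rewrite /pcomparable (comparable_ancs tree1 a1 b1) (comparable_ancs tree2 a2 b2).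
Qed.

Lemma pcomparable_anti_depth x y : pcomparable x y -> ~~ pre_le y x ->
  depth1 x.1 <= depth1 y.1 -> anc par1 x.1 y.1 /\ anc par2 y.2 x.2.
Proof.
move=> /andP[c1 c2] nle /(comparable_anc tree1 c1) a1; split=> //.
by move: nle c2; rewrite /Defs.pre_le a1 /= /Defs.comparable => /negPf ->.
Qed.

(* Pairwise comparable and incomparable for [pre_le]: the elements descend in the first tree as they ascend in the second, so [y] is squeezed between [x] and [z]. *)
Lemma pre_le_squeeze x y z e : pcomparable x y -> pcomparable y z ->
    ~~ pre_le y x -> ~~ pre_le z y ->
    depth1 x.1 <= depth1 y.1 -> depth1 y.1 <= depth1 z.1 ->
  (pre_le e x -> pre_le e z -> pre_le e y) /\ (pre_le x e -> pre_le z e -> pre_le y e).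
Proof.
move=> cxy cyz nyx nzy dxy dyz.
have [a1 a2] := pcomparable_anti_depth cxy nyx dxy.
have [b1 b2] := pcomparable_anti_depth cyz nzy dyz.
split=> /andP[e1 e2] /andP[f1 f2]; apply/andP; split.
- exact: (anc_trans tree1 b1 f1).
- exact: (anc_trans tree2 a2 e2).
- exact: (anc_trans tree1 e1 a1).
- exact: (anc_trans tree2 f2 b2).
Qed.

(** Ancestors of [e] at equal first depth share their first coordinate, and their second coordinates
    lie on one chain, so [pre_le] compares them. *)
Lemma antichain_depth1_inj e H x y : antichain H -> x \in H -> y \in H ->
  pre_le e x -> pre_le e y -> depth1 x.1 = depth1 y.1 -> x = y.
Proof.
move=> antiH xH yH /andP[a1 a2] /andP[b1 b2] /(anc_depth_inj tree1 a1 b1) e1.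
case/orP: (comparable_ancs tree2 a2 b2) => c.
  by apply/esym; apply: antiH; rewrite // /Defs.pre_le e1 (anc_refl tree1).
by apply: antiH; rewrite // /Defs.pre_le e1 (anc_refl tree1).
Qed.

Lemma antichain_depth2_inj e H x y : antichain H -> x \in H -> y \in H ->
  pre_le e x -> pre_le e y -> depth2 x.2 = depth2 y.2 -> x = y.
Proof.
move=> antiH xH yH /andP[a1 a2] /andP[b1 b2] /(anc_depth_inj tree2 a2 b2) e2.
case/orP: (comparable_ancs tree1 a1 b1) => c.
  by apply/esym; apply: antiH; rewrite // /Defs.pre_le e2 (anc_refl tree2) andbT.
by apply: antiH; rewrite // /Defs.pre_le e2 (anc_refl tree2) andbT.
Qed.

(** The depth of either coordinate is injective on [H], with [h1 + 1] and [h2 + 1] possible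
    values. *)
Lemma card_antichain (h1 h2 : nat) e H :
    leaves_at r1 par1 h1 -> leaves_at r2 par2 h2 ->
    antichain H -> (forall x, x \in H -> pre_le e x) ->
  #|H| <= (minn h1 h2).+1.
Proof.
move=> leaf1 leaf2 antiH eH; rewrite -minnSS leq_min; apply/andP; split.
- suff inj : {in H &, injective (fun x => inord (depth1 x.1) : 'I_h1.+1)}.
    by rewrite -(card_in_imset inj) -[leqRHS]card_ord max_card.
  move=> x y xH yH /(congr1 val) /=; rewrite !inordK ?ltnS ?(leaves_at_depth tree1) // => d_xy.
  exact: (antichain_depth1_inj antiH xH yH (eH _ xH) (eH _ yH)).
- suff inj : {in H &, injective (fun x => inord (depth2 x.2) : 'I_h2.+1)}.
    by rewrite -(card_in_imset inj) -[leqRHS]card_ord max_card.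
  move=> x y xH yH /(congr1 val) /=; rewrite !inordK ?ltnS ?(leaves_at_depth tree2) // => d_xy.
  exact: (antichain_depth2_inj antiH xH yH (eH _ xH) (eH _ yH)).
Qed.

(* The pairs of [H] that contribute to the double sum in [Fp]. *)
Definition edge H x y :=
  [&& x \in H, y \in H, y != x, pcomparable x y &
      [forall h, [&& h \in H, h != x & h != y] ==> ~~ pre_le (pglb x y) h]].

Lemma edge_sym H : symmetric (edge H).
Proof.
suff imp x y : edge H x y -> edge H y x by move=> x y; apply/idP/idP; apply: imp.
case/and5P=> xH yH ne cxy /forallP lone; rewrite /edge xH yH eq_sym ne pcomparableC cxy /=.
by apply/forallP => h; rewrite -pglbC // [X in _ && X]andbC; apply: lone.
Qed.

Lemma edge_irr H : irreflexive (edge H).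
Proof. by move=> x; rewrite /edge eqxx !andbF. Qed.

Lemma edge_lone H x y h :
  edge H x y -> h \in H -> pre_le (pglb x y) h -> h = x \/ h = y.
Proof.
case/and5P=> _ _ _ _ /forallP/(_ h) lone hH le_h.
have [->|nx] := eqVneq h x; first by left.
by right; apply/eqP; move: lone; rewrite hH nx le_h /= implybF negbK.
Qed.

Lemma edge_incomparable H x y : antichain H -> edge H x y -> ~~ pre_le x y.
Proof.
by move=> antiH /and5P[xH yH ne _ _]; apply: contra ne => /antiH ->.
Qed.

(** Order the elements of [H] above [e] by first depth. An element strictly between [x] and [z] lies
    above their glb, which forbids the edge, so only neighbours in this order are joined. *)
Lemma card_edges_above H e : antichain H ->
  \sum_(x in H) #|[set y | edge H x y & pre_le e (pglb x y)]|
     + 2 * [exists h in H, pre_le e h] <= 2 * #|[set h in H | pre_le e h]|.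
Proof.
move=> antiH; set C := [set h in H | _].
pose E x y := edge H x y && pre_le e (pglb x y).
have EC x y : E x y -> x \in C /\ y \in C.
  case/andP=> /and5P[xH yH _ cxy _]; rewrite pre_le_pglb // => /andP[ex ey].
  by rewrite !inE xH yH.
have -> : [exists h in H, pre_le e h] = (C != set0).
  apply/existsP/set0Pn => [] [h]; first by exists h; rewrite inE.
  by rewrite inE; exists h.
have -> : \sum_(x in H) #|[set y | edge H x y & pre_le e (pglb x y)]| =
          \sum_(x in C) #|[set y | E x y]|.
  rewrite (big_setID C) /= [X in _ + X]big1 ?addn0 => [|x].
    by apply: eq_bigl => x; rewrite !inE andbA andbb.
  rewrite inE => /andP[xC _]; apply/eqP; rewrite cards_eq0 -subset0; apply/subsetP => y.
  by rewrite inE => /EC[]; rewrite (negPf xC).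
apply: (@card_chain_neighbours _ C E (fun x => depth1 x.1)).
- by move=> x; rewrite /E edge_irr.
- move=> x y; rewrite /E edge_sym; case yx: (edge H y x) => //=.
  by case/and5P: yx => *; rewrite pglbC // pcomparableC.
- by move=> x y /EC[].
- move=> x y; rewrite !inE => /andP[xH ex] /andP[yH ey].
  exact: (antichain_depth1_inj antiH xH yH ex ey).
- move=> x y z; rewrite !inE => /andP[xH ex] /andP[yH ey] /andP[zH ez] dxy dyz.
  apply/negP => /andP[xz _].
  have nyx : ~~ pre_le y x.
    by apply/negP => /(antiH _ _ yH xH) yx; rewrite yx ltnn in dxy.
  have nzy : ~~ pre_le z y.
    by apply/negP => /(antiH _ _ zH yH) zy; rewrite zy ltnn in dyz.
  have [bet _] := pre_le_squeeze (pglb x z) (pre_le_pcomparable ex ey)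
    (pre_le_pcomparable ey ez) nyx nzy (ltnW dxy) (ltnW dyz).
  have cxz : pcomparable x z by case/and5P: xz.
  have /andP[gx gz] : pre_le (pglb x z) x && pre_le (pglb x z) z.
    by rewrite -pre_le_pglb // (pre_le_refl tree1 tree2).
  by case: (edge_lone xz yH (bet gx gz)) => eqy; move: dxy dyz; rewrite eqy ltnn.
Qed.
End Antichains.

(** * Maximal descendants *)

Section MaximalDescendants.
Variables (T1 : finType) (r1 : T1) (par1 : T1 -> T1).
Variables (T2 : finType) (r2 : T2) (par2 : T2 -> T2).
Hypotheses (tree1 : is_rtree r1 par1) (tree2 : is_rtree r2 par2).
Notation prefix := (T1 * T2)%type.
Local Notation level := (level r1 par1 r2 par2).
Local Notation pre_le := (pre_le par1 par2).
Local Notation pre_lt := (pre_lt par1 par2).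
Local Notation Hset := (Hset par1 par2).
Local Notation pedge := (edge par1 par2).
Local Notation pglb := (pglb par1 par2).
Local Notation antichain := (antichain par1 par2).
Local Notation depth1 := (Defs.depth r1 par1).
Implicit Types (e p q h x y z : prefix) (H P S : {set prefix}).

Lemma HsetP P p h : reflect
  [/\ h \in P, pre_lt h p & forall x, x \in P -> pre_lt h x -> pre_lt x p -> False]
  (h \in Hset P p).
Proof.
rewrite inE; apply: (iffP and3P) => [] [hP hp max_h]; split=> //.
  move=> x xP hx xp; move/forallP/(_ x): max_h; by rewrite xP hx xp.
by apply/forallP => x; apply/and3P => -[]; apply: max_h.
Qed.

Lemma Hset_antichain P p : antichain (Hset P p).
Proof.
move=> x y /HsetP[xP xp max_x] /HsetP[yP yp _] xy.
by apply/eqP/negPn/negP => ne; apply: (max_x y); rewrite // /Defs.pre_lt xy.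
Qed.

(** Among the elements of [P] that are above or equal to [x] and strictly below [p], one of least
    level is maximal, since a strictly higher prefix has a smaller level. *)
Lemma Hset_above P p x :
  x \in P -> pre_lt x p -> exists2 h, h \in Hset P p & pre_le x h.
Proof.
move=> xP xp; pose Q h := [&& h \in P, pre_le x h & pre_lt h p].
have Qx : Q x by rewrite /Q xP xp (pre_le_refl tree1 tree2).
have [h /and3P[hP xh hp] min_h] := @arg_minnP _ x Q level Qx.
exists h => //; apply/HsetP; split=> // y yP hy yp.
have /min_h : Q y.
  by rewrite /Q yP yp (pre_le_trans tree1 tree2 xh (pre_ltW hy)).
by rewrite leqNgt (pre_lt_level tree1 tree2 hy).
Qed.

(** [y] may lie outside [Hset P p]: squeezed strictly below [p], it is under some [h] of [Hset P p],
    and that [h] is above the glb of [x] and [z]. The edge forces [h] to be [x] or [z], against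
    incomparability with [y]. *)
Lemma edge_between P p x y z : pedge (Hset P p) x z -> y \in P ->
    pcomparable par1 par2 x y -> pcomparable par1 par2 y z ->
    ~~ pre_le x y -> ~~ pre_le y x -> ~~ pre_le y z -> ~~ pre_le z y ->
  depth1 x.1 <= depth1 y.1 -> depth1 y.1 <= depth1 z.1 -> False.
Proof.
move=> xz yP cxy cyz nxy nyx nyz nzy dxy dyz.
have [xH zH _ cxz _] := and5P xz.
have [_ xp _] := elimT (HsetP _ _ _) xH; have [_ zp _] := elimT (HsetP _ _ _) zH.
have [bg _] := pre_le_squeeze tree1 tree2 (pglb x z) cxy cyz nyx nzy dxy dyz.
have [_ bp] := pre_le_squeeze tree1 tree2 p cxy cyz nyx nzy dxy dyz.
have yp : pre_lt y p.
  rewrite /Defs.pre_lt bp ?pre_ltW //=.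
  by apply: contraNneq nxy => ->; apply: pre_ltW.
have [h hH yh] := Hset_above yP yp.
have /andP[gx gz] : pre_le (pglb x z) x && pre_le (pglb x z) z.
  by rewrite -(pre_le_pglb tree1 tree2) // (pre_le_refl tree1 tree2).
have gh := pre_le_trans tree1 tree2 (bg gx gz) yh.
by case: (edge_lone xz hH gh) => eqh; move: yh; rewrite eqh; apply/negP.
Qed.

Definition uncovered P p e := pre_le e p && ~~ [exists h in Hset P p, pre_le e h].

Section Residual.
Variables (P : {set prefix}) (s : seq (prefix * nat)).
Local Notation fcnt := (fcount par1 par2 s).

Definition residual p := \sum_(u <- s | uncovered P p u.1) u.2.

(** Item by item: if [c > 0] elements of [Hset P p] cover the item, at most [c - 1] edges have it
    below their glb; an uncovered item below [p] counts once on each side. The factor 2 is there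
    because the double sum runs over ordered pairs. *)
Lemma residual_inclusion_exclusion p :
  2 * fcnt p + \sum_(x in Hset P p) \sum_(y | pedge (Hset P p) x y) fcnt (pglb x y)
  <= 2 * residual p + 2 * \sum_(h in Hset P p) fcnt h.
Proof.
set H := Hset P p.
have weigh (Q : pred prefix) : \sum_(u <- s | Q u.1) u.2 = \sum_(u <- s) Q u.1 * u.2.
  by rewrite big_mkcond; apply: eq_bigr => u _; case: (Q _); rewrite ?mul1n.
have -> : \sum_(h in H) fcnt h = \sum_(u <- s) #|[set h in H | pre_le u.1 h]| * u.2.
  rewrite /fcount (eq_bigr (fun h => \sum_(u <- s) pre_le u.1 h * u.2)); last first.
    by move=> h _; apply: (weigh (fun e => pre_le e h)).
  rewrite exchange_big /=; apply: eq_bigr => u _; rewrite -big_distrl /=.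
  by rewrite -sum1dep_card big_mkcondr /=; congr (_ * _); apply: eq_bigr => h _; case: ifP.
have -> : \sum_(x in H) \sum_(y | pedge H x y) fcnt (pglb x y) =
   \sum_(u <- s) (\sum_(x in H) #|[set y | pedge H x y & pre_le u.1 (pglb x y)]|) * u.2.
  rewrite (eq_bigr (fun x => \sum_(u <- s)
     #|[set y | pedge H x y & pre_le u.1 (pglb x y)]| * u.2)); last first.
    move=> x _; rewrite /fcount.
    rewrite (eq_bigr (fun y => \sum_(u <- s) pre_le u.1 (pglb x y) * u.2)); last first.
      by move=> y _; rewrite (weigh (fun e => pre_le e (pglb x y))).
    rewrite exchange_big /=; apply: eq_bigr => u _; rewrite -big_distrl /=.
    congr (_ * _); rewrite -sum1dep_card [RHS]big_mkcondr /=.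
    by apply: eq_bigr => y _; case: ifP.
  by rewrite exchange_big /=; apply: eq_bigr => u _; rewrite big_distrl.
rewrite /fcount /residual (weigh (fun e => pre_le e p)) (weigh (uncovered P p)).
rewrite !big_distrr -!big_split /=; apply: leq_sum => u _.
rewrite !mulnA -!mulnDl leq_mul2r; apply/orP; right.
have := card_edges_above tree1 tree2 u.1 (@Hset_antichain P p).
rewrite /uncovered -/H; case: existsP => [[h /andP[hH uh]]|_] /=; last first.
  by rewrite andbT; lia.
have -> : pre_le u.1 p.
  by apply: (pre_le_trans tree1 tree2 uh); case/HsetP: hH => _ /pre_ltW.
by rewrite andbF; lia.
Qed.
End Residual.

(** * Double counting over a downward-closed subset *)

Section ClosedSubset.
Variables (h1 h2 : nat).
Hypotheses (leaf1 : leaves_at r1 par1 h1) (leaf2 : leaves_at r2 par2 h2).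
Local Notation A := (minn h1 h2).+1.
Variables (P S : {set prefix}).
Hypothesis subSP : S \subset P.
Hypothesis closedS : forall p h, p \in S -> h \in P -> pre_lt h p -> h \in S.

(** If [p] lay strictly below [q] and both had [h], then [p] would separate [h] from [q]; so these
    prefixes form an antichain above [h]. *)
Lemma card_owners h : #|[set p in S | h \in Hset P p]| <= A.
Proof.
apply: (card_antichain tree1 tree2 leaf1 leaf2 (e := h)) => [p q|p].
  rewrite inE => /andP[pS /HsetP[_ hp _]]; rewrite inE => /andP[qS /HsetP[_ _ max_h]] pq.
  apply/eqP/negPn/negP => ne; apply: (max_h p) => //; first exact: (subsetP subSP).
  by rewrite /Defs.pre_lt pq.
by rewrite inE => /andP[_ /HsetP[_ /pre_ltW hp _]].
Qed.

Lemma Hset_closed p h : p \in S -> h \in Hset P p -> h \in S.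
Proof. by move=> pS /HsetP[hP hp _]; apply: closedS hp. Qed.

Lemma sum_card_Hset : \sum_(p in S) #|Hset P p| <= A * #|S|.
Proof.
have -> : \sum_(p in S) #|Hset P p| = \sum_(p in S) \sum_(h in S) (h \in Hset P p).
  apply: eq_bigr => p pS; rewrite -sum1_card big_mkcond [RHS]big_mkcond /=.
  apply: eq_bigr => h _; case hH: (h \in Hset P p); last by rewrite if_same.
  by rewrite (Hset_closed pS hH).
rewrite exchange_big /= mulnC -sum_nat_const; apply: leq_sum => h _.
apply: leq_trans (card_owners h); rewrite -sum1dep_card big_mkcondr /=.
by apply: leq_sum => p _; case: ifP.
Qed.

(** The union of the glb graphs of all [p] in [S]: a single graph, to which Mantel's theorem
    applies. *)
Definition some_edge x y := [exists p in S, pedge (Hset P p) x y].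

Lemma some_edgeP x y :
  reflect (exists2 p, p \in S & pedge (Hset P p) x y) (some_edge x y).
Proof. exact: exists_inP. Qed.

Lemma some_edge_sym : symmetric some_edge.
Proof.
by move=> x y; apply/some_edgeP/some_edgeP => -[p pS xy]; exists p; rewrite // (edge_sym tree1 tree2).
Qed.

Lemma some_edge_prop x y : some_edge x y ->
  [/\ x \in S, pcomparable par1 par2 x y & ~~ pre_le x y].
Proof.
case/some_edgeP => p pS xy; have [xH _ _ cxy _] := and5P xy; split=> //.
  exact: Hset_closed pS xH.
by apply: edge_incomparable xy; apply: Hset_antichain.
Qed.

(** The edge from [x] to [z] fixes a [p]. The other two may come from other prefixes; they supply
    that [y] is in [S], coordinatewise comparable with both ends and incomparable to them under
    [pre_le]. *)
Lemma some_edge_ordered_triangle x y z :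
    some_edge x y -> some_edge y z -> some_edge x z ->
  depth1 x.1 <= depth1 y.1 -> depth1 y.1 <= depth1 z.1 -> False.
Proof.
move=> xy yz /some_edgeP[p pS xz].
have [_ cxy nxy] := some_edge_prop xy; have [yS cyz nyz] := some_edge_prop yz.
rewrite some_edge_sym in xy; rewrite some_edge_sym in yz.
have [_ _ nyx] := some_edge_prop xy; have [_ _ nzy] := some_edge_prop yz.
exact: (edge_between xz (subsetP subSP _ yS)).
Qed.

Lemma some_edge_triangle x y z :
  some_edge x y -> some_edge y z -> some_edge x z -> False.
Proof.
move=> xy yz xz; have sym := some_edge_sym.
have [yx zy zx] : [/\ some_edge y x, some_edge z y & some_edge z x].
  by rewrite sym xy sym yz sym.
have tri := some_edge_ordered_triangle.
(* In every case some listing of the three vertices has weakly increasing first depths. *)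
have [dxy|/ltnW dyx] := leqP (depth1 x.1) (depth1 y.1);
  have [dyz|/ltnW dzy] := leqP (depth1 y.1) (depth1 z.1);
  have [dxz|/ltnW dzx] := leqP (depth1 x.1) (depth1 z.1).
- exact: (tri x y z).
- exact: (tri x y z).
- exact: (tri x z y).
- exact: (tri z x y).
- exact: (tri y x z).
- exact: (tri y z x).
- exact: (tri z y x).
- exact: (tri z y x).
Qed.

(** An edge at [x] arises only from those [p] with [x] in [Hset P p], at most [A] of them, so the
    total is at most [A] times the degree sum of the union graph. *)
Lemma sum_edges : 2 * \sum_(p in S) \sum_(x in Hset P p)
  #|[set y | pedge (Hset P p) x y]| <= A * #|S| ^ 2.
Proof.
have := mantel some_edge_sym (fun x y xy => and3_rec (fun a _ _ => a) (some_edge_prop xy))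
  some_edge_triangle.
rewrite -(@leq_pmul2l A) // mulnCA; apply: leq_trans.
rewrite leq_pmul2l //.
have -> : \sum_(p in S) \sum_(x in Hset P p) #|[set y | pedge (Hset P p) x y]| =
    \sum_(p in S) \sum_(x in S) \sum_y (pedge (Hset P p) x y).
  apply: eq_bigr => p pS; rewrite big_mkcond [RHS]big_mkcond /=; apply: eq_bigr => x _.
  rewrite -sum1dep_card big_mkcond /=.
  case xH: (x \in Hset P p); first rewrite (Hset_closed pS xH).
    by apply: eq_bigr => y _; case: (pedge _ _ _).
  case: ifP => // _; rewrite big1 // => y _.
  by rewrite /edge xH.
rewrite exchange_big /= big_distrr /=; apply: leq_sum => x _.
rewrite exchange_big /= -sum1dep_card big_distrr [leqRHS]big_mkcond /=.
apply: leq_sum => y _; case: ifP => [_|/negbT nxy].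
  rewrite muln1; apply: leq_trans (card_owners x); rewrite -sum1dep_card big_mkcondr /=.
  by apply: leq_sum => p _; case xy: (pedge _ _ _) => //; case/and5P: xy => ->.
rewrite big1 // => p pS; apply/eqP; rewrite eqb0; apply: contra nxy => xy.
by apply/some_edgeP; exists p.
Qed.

(** If [p] in [S] lies strictly below [q], some [h] in [Hset P q] lies above [p] and covers every
    item of [p]; so prefixes leaving [e] uncovered are never nested. *)
Lemma card_uncovered e : #|[set p in S | uncovered P p e]| <= A.
Proof.
apply: (card_antichain tree1 tree2 leaf1 leaf2 (e := e)) => [p q|p].
  rewrite !inE => /andP[pS /andP[ep _]] /andP[qS /andP[eq nq]] pq.
  apply: contraNeq nq => ne.
  have pq' : pre_lt p q by rewrite /Defs.pre_lt pq.
  have [h hH ph] := Hset_above (subsetP subSP _ pS) pq'.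
  by apply/exists_inP; exists h; rewrite // (pre_le_trans tree1 tree2 ep).
by rewrite inE => /andP[_ /andP[]].
Qed.

Lemma sum_residual (s : seq (prefix * nat)) : \sum_(p in S) residual P s p <= A * stream_N s.
Proof.
rewrite /residual (eq_bigr (fun p => \sum_(u <- s) uncovered P p u.1 * u.2)); last first.
  by move=> p _; rewrite big_mkcond; apply: eq_bigr => u _; case: uncovered; rewrite ?mul1n.
rewrite exchange_big /stream_N big_distrr /=; apply: leq_sum => u _.
rewrite -big_distrl leq_mul2r; apply/orP; right.
apply: leq_trans (card_uncovered u.1); rewrite -sum1dep_card big_mkcondr /=.
by apply: leq_sum => p _; case: uncovered.
Qed.

End ClosedSubset.

(** Deleting an element of least level keeps the set closed, as it lies strictly below no other
    element. Every size [j] is provided so that the quadratic inequality can be tested between its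
    roots. *)
Lemma exists_closed_subset P j : j <= #|P| -> exists S : {set prefix},
  [/\ S \subset P, #|S| = j & forall p h, p \in S -> h \in P -> pre_lt h p -> h \in S].
Proof.
move=> le_jP; rewrite -(subKn le_jP); elim: (#|P| - j) => {le_jP j} [|i [S [sSP cS clS]]].
  by exists P; split; rewrite ?subn0.
have [S0|[x0 x0S]] := set_0Vmem S.
  by exists S; split=> //; move: cS; rewrite S0 cards0; lia.
have [x xS min_x] := @arg_minnP _ x0 (mem S) level x0S.
exists (S :\ x); split=> [||p h].
- by apply: subset_trans sSP; rewrite subD1set.
- by move: cS; rewrite (cardsD1 x S) (xS : x \in S); lia.
rewrite !inE => /andP[_ pS] hP hp; rewrite (clS p) // andbT.
apply: contraTneq (pre_lt_level tree1 tree2 hp) => ->; rewrite -leqNgt.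
exact: min_x.
Qed.
End MaximalDescendants.

(** * The output set *)

Section OutputBound.
Variables (T1 : finType) (r1 : T1) (par1 : T1 -> T1).
Variables (T2 : finType) (r2 : T2) (par2 : T2 -> T2).
Hypotheses (tree1 : is_rtree r1 par1) (tree2 : is_rtree r2 par2).
Notation prefix := (T1 * T2)%type.
Local Notation level := (level r1 par1 r2 par2).
Local Notation pre_le := (pre_le par1 par2).
Local Notation pre_lt := (pre_lt par1 par2).
Local Notation Hset := (Hset par1 par2).
Local Notation pedge := (edge par1 par2).
Local Notation pglb := (pglb par1 par2).
Implicit Types (e p q h x y z : prefix) (H P Q S : {set prefix}).
Variables (R : realType) (k : nat) (s : seq (prefix * nat)) (St : alg_state T1 T2).
Hypotheses (k_gt0 : 0 < k).
Hypothesis run : alg_run r1 par1 r2 par2 k (alg_init T1 T2) s St.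
Local Notation fcnt := (fcount par1 par2 s).
Local Notation fmax := (fmax r1 par1 r2 par2 k St).
Local Notation fmin := (fmin r1 par1 r2 par2 St).
Local Notation N := (stream_N s).
Local Notation Fp := (@Fp _ r1 par1 _ r2 par2 R k St).
Local Notation outQ := (@outQ _ r1 par1 _ r2 par2 R k St).
Local Notation output := (@output _ r1 par1 _ r2 par2 R k St).
Local Open Scope ring_scope.

Lemma outQ_sub phi L n n' : (n <= n')%N -> outQ phi N L n \subset outQ phi N L n'.
Proof.
move/subnK <-; elim: (n' - n)%N => //= i IHi.
by apply: subset_trans IHi _; apply: subsetUl.
Qed.

Lemma outQP phi L n p : p \in outQ phi N L n -> exists n', [/\ (n' < n)%N,
  level p = (L - n')%N & phi * N%:R <= Fp (outQ phi N L n') p].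
Proof.
elim: n => [|n IHn] /=; first by rewrite inE.
rewrite in_setU in_set => /orP[/IHn[n' [lt_n lp Fn]]|/andP[/eqP lp Fn]].
  by exists n'; split=> //; apply: ltnW.
by exists n.
Qed.

Lemma Hset_eq P Q p :
  (forall h, pre_lt h p -> (h \in P) = (h \in Q)) -> Hset P p = Hset Q p.
Proof.
move=> eqPQ; apply/setP => h; rewrite !inE.
case hp: (pre_lt h p); last by rewrite !andbF.
rewrite (eqPQ _ hp); congr (_ && _); rewrite /=; apply: eq_forallb => x.
by case xp: (pre_lt x p); rewrite ?andbF // (eqPQ _ xp).
Qed.

(** Nothing added to the output from the level of [p] on lies strictly below [p], so [Hset] at the
    time of the test agrees with the final one. *)
Lemma output_threshold phi L p : let P := output phi N L in
  p \in P -> phi * N%:R <= Fp P p.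
Proof.
move=> P /outQP[n [lt_nL lp le_F]].
rewrite /Defs.Fp -(_ : Hset (outQ phi N L n) p = Hset P p) //.
apply: Hset_eq => h hp; apply/idP/idP => [|/outQP[n' [lt_n' lh Fh]]].
  by apply/subsetP; apply: outQ_sub; apply: ltnW.
have lt_n'n : (n' < n)%N by have := pre_lt_level tree1 tree2 hp; rewrite lh lp; lia.
have /subsetP := outQ_sub phi L lt_n'n; apply.
by rewrite /= in_setU in_set lh eqxx Fh orbT.
Qed.

Local Notation err := (N%:R / k%:R : R).

Lemma fmax_leR p : (fmax p)%:R <= (fcnt p)%:R + err.
Proof.
have k0 : (0 : R) < k%:R by rewrite ltr0n.
rewrite -(ler_pM2r k0) mulrDl divfK ?gt_eqF // -!natrM -natrD ler_nat.
exact: fmax_le.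
Qed.

Lemma fmin_geR p : (fcnt p)%:R - err <= (fmin p)%:R.
Proof.
have k0 : (0 : R) < k%:R by rewrite ltr0n.
rewrite lerBlDr -(ler_pM2r k0) mulrDl divfK ?gt_eqF // -!natrM -natrD ler_nat.
exact: fmin_ge.
Qed.

Lemma pair_term_edge H h : h \in H ->
  \sum_(h' in H | h' != h) pair_term r1 par1 r2 par2 R k St H h h' =
  \sum_(y | pedge H h y) (fmax (pglb h y))%:R.
Proof.
move=> hH; rewrite big_mkcond [RHS]big_mkcond; apply: eq_bigr => y _.
rewrite /edge hH /=; case: (y \in H); case: (y != h) => //=.
by rewrite /pair_term /glb /pcomparable; case: ifP.
Qed.

(** Inclusion-exclusion bounds the exact part, and each estimate in [Fp] costs at most [err]; the
    factor [2^-1] compensates for ordered pairs. *)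
Lemma Fp_le P p : Fp P p <= (residual par1 par2 P s p)%:R +
  err * (1 + #|Hset P p|%:R + 2^-1 * (\sum_(x in Hset P p) #|[set y | pedge (Hset P p) x y]|)%:R).
Proof.
have := residual_inclusion_exclusion tree1 tree2 P s p.
rewrite -(ler_nat R) natrD [leRHS]natrD !natrM.
rewrite /Defs.Fp; set H := Hset P p => ie.
rewrite [X in _ - _ + 2^-1 * X <= _](eq_bigr (fun h => \sum_(y | pedge H h y) (fmax (pglb h y))%:R)); last first.
  by move=> h; apply: pair_term_edge.
have le_min : (\sum_(h in H) fcnt h)%:R - err * #|H|%:R <= \sum_(h in H) (fmin h)%:R :> R.
  rewrite natr_sum mulr_natr -sumr_const -sumrB.
  by apply: ler_sum => h _; apply: fmin_geR.
have le_pairs : \sum_(h in H) \sum_(y | pedge H h y) (fmax (pglb h y))%:R <=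
    (\sum_(h in H) \sum_(y | pedge H h y) fcnt (pglb h y))%N%:R +
    err * (\sum_(h in H) #|[set y | pedge H h y]|)%N%:R.
  rewrite natr_sum [X in _ + err * X]natr_sum mulr_sumr -big_split /=; apply: ler_sum => h _.
  rewrite natr_sum mulr_natr -sumr_const [X in _ <= _ + X](eq_bigl (pedge H h)) => [|y]; last by rewrite in_set.
  by rewrite -big_split /=; apply: ler_sum => y _; apply: fmax_leR.
have := fmax_leR p; lra.
Qed.

Variables (h1 h2 : nat).
Hypotheses (leaf1 : leaves_at r1 par1 h1) (leaf2 : leaves_at r2 par2 h2).
Local Notation A := ((minn h1 h2).+1%:R : R).

Lemma output_card_quadratic phi L j : (0 < N)%N -> (j <= #|output phi N L|)%N ->
  phi * j%:R <= A + (k%:R)^-1 * (j%:R + A * j%:R + A * j%:R ^+ 2 / 4).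
Proof.
move=> N_gt0; set P := output phi N L => /(exists_closed_subset tree1 tree2)[S [sSP cS clS]].
have N0 : (0 : R) < N%:R by rewrite ltr0n.
have sumF : \sum_(p in S) phi * N%:R <= \sum_(p in S) ((residual par1 par2 P s p)%:R +
  err * (1 + #|Hset P p|%:R + 2^-1 * (\sum_(x in Hset P p) #|[set y | pedge (Hset P p) x y]|)%:R)).
  apply: ler_sum => p /(subsetP sSP) pP.
  by apply: le_trans (Fp_le _ _); apply: output_threshold.
move: sumF; rewrite sumr_const cS -[_ *+ j]mulr_natr big_split -mulr_sumr !big_split /= -mulr_sumr.
rewrite sumr_const cS -!natr_sum => sumF.
have := sum_residual tree1 tree2 leaf1 leaf2 sSP s.
have := sum_card_Hset tree1 tree2 leaf1 leaf2 sSP clS.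
have := sum_edges tree1 tree2 leaf1 leaf2 sSP clS.
rewrite cS -!(ler_nat R) !natrM => leE leH leU.
rewrite -(ler_pM2r N0); set E := (\sum_(i in S) \sum_(x in _) _)%N in sumF leE.
(* The 4 under [A * j%:R ^+ 2] combines two halvings: one for unordered pairs, one from the factor 2
   in [sum_edges]. *)
apply: (@le_trans _ _ (A * N%:R + err * (j%:R + A * j%:R + 2^-1 * (A * j%:R ^+ 2 / 2)))); last first.
  by rewrite le_eqVlt; apply/orP; left; apply/eqP; field; rewrite pnatr_eq0 -lt0n.
rewrite mulrAC; apply: le_trans sumF _; apply: lerD => //.
apply: ler_wpM2l; first by rewrite divr_ge0.
lra.
Qed.
End OutputBound.

(** * The smaller root of the quadratic *)

Section Quadratic.
Variable R : realType.
Local Open Scope ring_scope.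

(* The quadratic inequality only says that [n] lies outside the open interval between the two roots; since it also holds below [n] and the roots are more than 1 apart, [n] cannot be on the far side. *)
Lemma le_smaller_root (A eps phi : R) (n : nat) :
    0 < phi <= 1 -> 1 <= A -> 0 < eps -> eps < phi ^+ 2 / (16 * A ^+ 2) ->
    (forall j : nat, (j <= n)%N ->
       phi * j%:R <= A + eps * (j%:R + A * j%:R + A * j%:R ^+ 2 / 4)) ->
  n%:R <= 2 / (A * eps) * (phi - (1 + A) * eps -
    Num.sqrt ((phi - (1 + A) * eps) ^+ 2 - A ^+ 2 * eps)).
Proof.
move=> /andP[phi0 phi1] A1 eps0; rewrite ltr_pdivlMr; last by nra.
move=> eps_lt quad; set B := phi - _.
have Ae : A ^+ 2 * eps < phi ^+ 2 / 16 by lra.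
have Ae1 : A * eps < phi ^+ 2 / 16 by nra.
have phi2 : phi ^+ 2 <= phi by nra.
have B_ge : 7 / 8 * phi <= B.
  rewrite /B; have : eps <= A * eps by nra.
  lra.
have disc : phi ^+ 2 / 4 <= B ^+ 2 - A ^+ 2 * eps by nra.
set D := Num.sqrt _.
have D2 : D ^+ 2 = B ^+ 2 - A ^+ 2 * eps by rewrite sqr_sqrtr //; nra.
(* The roots are [2 * (B - D) / (A * eps)] and [2 * (B + D) / (A * eps)]; with [D >= phi / 2] and
   the bound [Ae1] their distance exceeds 1. *)
have D_ge : phi / 2 <= D.
  rewrite -(@ler_pXn2r _ 2) // ?nnegrE ?sqrtr_ge0 ?D2; lra.
have Ae0 : 0 < A * eps by nra.
have DB : D <= B.
  by rewrite -(@ler_pXn2r _ 2) // ?nnegrE ?sqrtr_ge0 ?D2; nra.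
set x := 2 / (A * eps) * (B - D).
have x0 : 0 <= x by rewrite mulr_ge0 ?divr_ge0 // ?subr_ge0 //; lra.
have xE : A * eps * x = 2 * (B - D) by rewrite /x; field; rewrite ?gt_eqF //; nra.
rewrite leNgt; apply/negP => lt_xn.
have /andP[le_tx lt_xt] := Num.Theory.truncn_itv x0.
(* [j] is the first integer above the smaller root [x], so [x < j <= x + 1] puts it strictly between
   the roots, while [j <= n]. *)
set j := (Num.truncn x).+1 in lt_xt.
have le_jn : (j <= n)%N by rewrite -(ltr_nat R) (le_lt_trans le_tx).
have j_le : j%:R <= x + 1 by rewrite /j -natr1 lerD2r.
have := quad j le_jn; apply/negP; rewrite -ltNge.
have e1 : 0 < A * eps * j%:R - 2 * (B - D).
  by rewrite -xE -mulrBr mulr_gt0 ?subr_gt0.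
have e2 : A * eps * j%:R - 2 * (B + D) < 0.
  have : A * eps * j%:R <= A * eps * (x + 1) by rewrite ler_pM2l.
  rewrite mulrDr xE; lra.
have : (A * eps * j%:R - 2 * (B - D)) * (A * eps * j%:R - 2 * (B + D)) < 0.
  by rewrite pmulr_rlt0.
(* Up to the factor [4 * (A * eps)] the quadratic splits over its roots, as
   [A ^+ 2 * eps = B ^+ 2 - D ^+ 2]. *)
have -> : (A * eps * j%:R - 2 * (B - D)) * (A * eps * j%:R - 2 * (B + D)) =
   4 * (A * eps) * (A + eps * (j%:R + A * j%:R + A * j%:R ^+ 2 / 4) - phi * j%:R).
  transitivity ((A * eps * j%:R) ^+ 2 - 4 * B * (A * eps * j%:R) + 4 * (B ^+ 2 - D ^+ 2)).
    by ring.
  by rewrite D2 /B; field.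
by rewrite pmulr_rlt0 ?subr_lt0 //; lra.
Qed.
End Quadratic.
Local Open Scope ring_scope.

Theorem theorem5 (R : realType) (h1 h2 : nat) (phi : R) :
  0 < phi <= 1 ->
  let A : R := ((minn h1 h2).+1)%:R in
  exists eps0 : R, 0 < eps0 /\
  forall (T1 : finType) (r1 : T1) (par1 : T1 -> T1)
         (T2 : finType) (r2 : T2) (par2 : T2 -> T2),
    is_rtree r1 par1 -> leaves_at r1 par1 h1 ->
    is_rtree r2 par2 -> leaves_at r2 par2 h2 ->
    forall k : nat, (0 < k)%N -> (k%:R : R)^-1 < eps0 ->
    forall (s : seq ((T1 * T2) * nat)),
      valid_stream par1 par2 s -> (0 < stream_N s)%N ->
    forall St : alg_state T1 T2,
      alg_run r1 par1 r2 par2 k (alg_init T1 T2) s St ->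
    let eps : R := (k%:R)^-1 in
    let P := output r1 par1 r2 par2 k St phi (stream_N s) (h1 + h2) in
    (#|P|%:R : R) <= 2 / (A * eps) *
       (phi - (1 + A) * eps - Num.sqrt ((phi - (1 + A) * eps) ^+ 2 - A ^+ 2 * eps)).
Proof.
(* Below this [eps0], [A ^+ 2 * eps] is less than [phi ^+ 2 / 16], which keeps the discriminant at
   least [phi ^+ 2 / 4] and the roots more than 1 apart. *)
move=> phi01 A; exists (phi ^+ 2 / (16 * A ^+ 2)).
have A1 : 1 <= A by rewrite ler1n.
split; first by case/andP: phi01 => phi0 _; rewrite divr_gt0 ?exprn_gt0 // mulr_gt0 ?exprn_gt0 //; lra.
move=> T1 r1 par1 T2 r2 par2 tree1 leaf1 tree2 leaf2 k k0 k_eps s _ N0 St run.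
cbv zeta; apply: le_smaller_root => // [|j le_jP]; first by rewrite invr_gt0 ltr0n.
exact: (output_card_quadratic tree1 tree2 k0 run leaf1 leaf2 N0 le_jP).
Qed.
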